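(* For any integer $n\ge1$ we have, in $\hat U_q[[z^{-1}]]$, $$X_0^+(z)^n=\sum_{0\le m_n\le\cdots\le m_1}c_{m_n,\ldots,m_1}(q)\,x_{m_n}\cdots x_{m_1}\,z^{-(m_1+\cdots+m_n)},$$ $$Y_0^+(z)^n=\sum_{0\le m_n\le\cdots\le m_1}c_{m_n,\ldots,m_1}(q)\,y_{m_1}\cdots y_{m_n}\,z^{-(m_1+\cdots+m_n)},$$ where $$c_{m_n,\ldots,m_1}(q)=\frac{[n]!}{[l_1]!\cdots[l_j]!}\,q^{\sum_{i=1}^n2(i-1)m_i+\left(n(n-1)-\sum_{i=1}^jl_i(l_i-1)\right)/2}$$ is in $\mathbb{Z}[q,q^{-1}]$.
   Context: Let $q$ be an indeterminate; $[n]=\frac{q^n-q^{-n}}{q-q^{-1}}$, $[n]!=[n][n-1]\cdots[1]$, $[0]!=1$. $\hat U_q$ is the $\mathbb{C}(q)$-algebra with generators $x_n,y_n$ ($n\in\mathbb{Z}$), $h_k$ ($k\in\mathbb{Z}\setminus\{0\}$), $K^{\pm1}$, $c^{\pm1/2}$ and defining relations: $KK^{-1}=K^{-1}K=1$; $c^{1/2}c^{-1/2}=c^{-1/2}c^{1/2}=1$ and $c^{1/2}$ is central; $[h_m,h_n]=\delta_{m,-n}\frac{[2m]}{m}\frac{c^m-c^{-m}}{q-q^{-1}}$; $Kh_m=h_mK$; $Kx_mK^{-1}=q^2x_m$, $Ky_mK^{-1}=q^{-2}y_m$; $[h_m,x_n]=\frac{[2m]}{m}c^{-|m|/2}x_{m+n}$;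 $[h_m,y_n]=-\frac{[2m]}{m}c^{|m|/2}y_{m+n}$; $x_{m+1}x_n-q^2x_nx_{m+1}=q^2x_mx_{n+1}-x_{n+1}x_m$; $y_{m+1}y_n-q^{-2}y_ny_{m+1}=q^{-2}y_my_{n+1}-y_{n+1}y_m$; $[x_m,y_n]=\frac{c^{(m-n)/2}\psi_{m+n}-c^{-(m-n)/2}\phi_{m+n}}{q-q^{-1}}$; where $\psi_{-m}=0=\phi_m$ for $m>0$ and $\psi_m,\phi_{-m}$ ($m\ge0$) are given by $\sum_{m\ge0}\psi_mz^{-m}=K\exp\bigl((q-q^{-1})\sum_{m\ge1}h_mz^{-m}\bigr)$ and $\sum_{m\ge0}\phi_{-m}z^m=K^{-1}\exp\bigl(-(q-q^{-1})\sum_{m\ge1}h_{-m}z^m\bigr)$. Here $c^{k/2}=(c^{1/2})^k$. For an indeterminate $z$: $X_0^+(z)=\sum_{k\ge0}x_kz^{-k}$, $Y_0^+(z)=\sum_{k\ge0}y_kz^{-k}$. The sums in the claim run over $n$-tuples of integers $(m_n,\ldots,m_1)$ with $0\le m_n\le\cdots\le m_1$. Given an $n$-tuple $(m_n,\ldots,m_1)$ with $0\le m_n\le\cdots\le m_1$, the tuple $(l_1,\ldots,l_j)$ is its tuple of multiplicities of distinct entries in order: $l_1$ is the number of occurrences of $m_n$ in $(m_n,\ldots,m_1)$, $l_2$ the number of occurrences of $m_{n-l_1}$, ..., $l_j$ the number of occurrences of $m_{n-l_1-\cdots-l_{j-1}}$, so $n=\sum_{i=1}^jl_i$. (E.g.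 $(1,1,2,2,3,5,5,5)$ gives $(2,2,1,3)$.) *)

(* Defs.v *)
From HB Require Import structures.
From mathcomp Require Import all_boot all_order all_algebra.
From mathcomp Require Import complex monalg.
From mathcomp Require Import boolp classical_sets cardinality fsbigop reals.

Set Implicit Arguments.
Unset Strict Implicit.
Unset Printing Implicit Defensive.

Import GRing.Theory.

Local Open Scope ring_scope.
Local Open Scope quotient_scope.

(* Formal power series in one central variable u over a possibly
   noncommutative ring A; [f k] is the coefficient of [u ^ k].  The variable
   u stands for z or for z^-1, depending on the series. *)

Record fps (A : Type) := Fps { fps_coef :> nat -> A }.

Section FpsRing.
Variable A : pzRingType.

HB.instance Definition _ := [isNew for @fps_coef A].
HB.instance Definition _ := [Choice of fps A by <:].

Implicit Types f g h : fps A.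

Lemma fpsP f g : f =1 g -> f = g.
Proof. by move=> fg; apply: val_inj; apply/funext. Qed.

Definition fpsC (a : A) : fps A := Fps (fun k => if k == 0%N then a else 0).
Definition fps_monom (a : A) (n : nat) : fps A :=
  Fps (fun k => if k == n then a else 0).
Definition fps_zero : fps A := Fps (fun=> 0).
Definition fps_opp f : fps A := Fps (fun k => - f k).
Definition fps_add f g : fps A := Fps (fun k => f k + g k).
Definition fps_mul f g : fps A :=
  Fps (fun k => \sum_(i < k.+1) f i * g (k - i)%N).

Fact fps_addA : associative fps_add.
Proof. by move=> f g h; apply: fpsP => k /=; rewrite addrA. Qed.
Fact fps_addC : commutative fps_add.
Proof. by move=> f g; apply: fpsP => k /=; rewrite addrC. Qed.
Fact fps_add0 : left_id fps_zero fps_add.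
Proof. by move=> f; apply: fpsP => k /=; rewrite add0r. Qed.
Fact fps_addN : left_inverse fps_zero fps_opp fps_add.
Proof. by move=> f; apply: fpsP => k /=; rewrite addNr. Qed.

HB.instance Definition _ := GRing.isZmodule.Build (fps A)
  fps_addA fps_addC fps_add0 fps_addN.

Lemma fps_mul_rev f g k :
  fps_mul f g k = \sum_(i < k.+1) f (k - i)%N * g i.
Proof.
rewrite /= (reindex_inj rev_ord_inj) /=.
by apply: eq_bigr => i _; rewrite subSS subKn // leq_ord.
Qed.

Fact fps_mulA : associative fps_mul.
Proof.
move=> f g h; apply: fpsP => n; rewrite [RHS]fps_mul_rev.
pose c i j := f i * (g (n - i - j)%N * h j).
transitivity (\sum_(i < n.+1) \sum_(j < n.+1 | (j <= n - i)%N) c i j).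
  apply: eq_bigr => i _; rewrite -/(fps_coef (fps_mul g h) (n - i)%N).
  by rewrite fps_mul_rev big_distrr /= (big_ord_narrow_leq (leq_subr _ _)).
rewrite (exchange_big_dep predT) //=; apply: eq_bigr => j _.
transitivity (\sum_(i < n.+1 | (i <= n - j)%N) c i j).
  apply: eq_bigl => i; rewrite -ltnS -(ltnS i) -!subSn ?leq_ord //.
  by rewrite -subn_gt0 -(subn_gt0 i) -!subnDA addnC.
rewrite (big_ord_narrow_leq (leq_subr _ _)) big_distrl /=.
by apply: eq_bigr => i _; rewrite /c mulrA -!subnDA addnC.
Qed.

Fact fps_mul1 : left_id (fpsC 1) fps_mul.
Proof.
move=> f; apply: fpsP => k /=; rewrite big_ord_recl /= mul1r subn0.
by rewrite big1 ?addr0 // => i _; rewrite mul0r.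
Qed.

Fact fps_mulr1 : right_id (fpsC 1) fps_mul.
Proof.
move=> f; apply: fpsP => k /=; rewrite big_ord_recr /= subnn mulr1.
by rewrite big1 ?add0r // => i _; rewrite subn_eq0 leqNgt ltn_ord mulr0.
Qed.

Fact fps_mulDl : left_distributive fps_mul +%R.
Proof.
move=> f g h; apply: fpsP => k /=.
by rewrite -big_split; apply: eq_bigr => i _; rewrite mulrDl.
Qed.

Fact fps_mulDr : right_distributive fps_mul +%R.
Proof.
move=> f g h; apply: fpsP => k /=.
by rewrite -big_split; apply: eq_bigr => i _; rewrite mulrDr.
Qed.

HB.instance Definition _ := GRing.Zmodule_isPzRing.Build (fps A)
  fps_mulA fps_mul1 fps_mulr1 fps_mulDl fps_mulDr.

(* [S] is the sum of the family [F] over [D] in A[[u]]: only finitely many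
   members contribute to each coefficient.  The finiteness clause is needed
   because [\sum_(i \in D)] is 0 on families with infinite support. *)
Definition is_fps_sum (I : choiceType) (D : set I) (F : I -> fps A)
    (S : fps A) : Prop :=
  forall k, finite_set [set i | D i /\ F i k <> 0]%classic /\
            S k = \sum_(i \in D) F i k.

End FpsRing.

(* exp f = \sum_j f ^ j / j!, for f without constant term, when K has
   characteristic 0: then [f ^+ j] has
   no term of degree < j, so the sum in degree k stops at j = k. *)
Definition fps_exp (K : fieldType) (A : lalgType K) (f : fps A) : fps A :=
  Fps (fun k => \sum_(j < k.+1) (j`!%:R : K)^-1 *: (f ^+ j) k).

(* The quotient of an algebra by the two-sided ideal generated by the
   differences [a - b] with [E a b]. *)

Section Ideal.
Variables (A : pzRingType) (E : A -> A -> Prop).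

Inductive rel_ideal : A -> Prop :=
| rel_ideal_gen a b : E a b -> rel_ideal (a - b)
| rel_ideal0 : rel_ideal 0
| rel_idealD a b : rel_ideal a -> rel_ideal b -> rel_ideal (a + b)
| rel_idealMl a b : rel_ideal b -> rel_ideal (a * b)
| rel_idealMr a b : rel_ideal a -> rel_ideal (a * b).

Lemma rel_idealN a : rel_ideal a -> rel_ideal (- a).
Proof. by rewrite -mulN1r; exact: rel_idealMl. Qed.

Lemma rel_idealB a b : rel_ideal a -> rel_ideal b -> rel_ideal (a - b).
Proof. by move=> Ia Ib; apply: rel_idealD Ia (rel_idealN Ib). Qed.

End Ideal.

Section QuotientAlgebra.
Variables (K : comNzRingType) (A : algType K) (E : A -> A -> Prop).

Local Notation rel_ideal := (rel_ideal E).

Definition rel_equiv : rel A := fun a b => `[< rel_ideal (a - b) >].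

Fact rel_equiv_refl : reflexive rel_equiv.
Proof. by move=> a; apply/asboolP; rewrite subrr; apply: rel_ideal0. Qed.
Fact rel_equiv_sym : symmetric rel_equiv.
Proof.
by move=> a b; apply/asboolP/asboolP => /rel_idealN; rewrite opprB.
Qed.
Fact rel_equiv_trans : transitive rel_equiv.
Proof.
move=> b a c /asboolP Iab /asboolP Ibc; apply/asboolP.
by rewrite -(subrKA b); apply: rel_idealD.
Qed.
Canonical rel_equiv_canonical :=
  EquivRel rel_equiv rel_equiv_refl rel_equiv_sym rel_equiv_trans.

Definition quot_alg := {eq_quot rel_equiv}.
HB.instance Definition _ := Choice.on quot_alg.
HB.instance Definition _ := EqQuotient.on quot_alg.

Definition to_quot (a : A) : quot_alg := \pi a.

Lemma to_quotP a b : to_quot a = to_quot b <-> rel_ideal (a - b).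
Proof. by split=> [/eqmodP/asboolP //|Iab]; apply/eqmodP/asboolP. Qed.

Lemma to_quot_repr (x : quot_alg) : to_quot (repr x) = x.
Proof. exact: reprK. Qed.

Lemma repr_to_quot a : rel_ideal (repr (to_quot a) - a).
Proof. by apply/to_quotP; rewrite to_quot_repr. Qed.

Definition quot_add (x y : quot_alg) := to_quot (repr x + repr y).
Definition quot_opp (x : quot_alg) := to_quot (- repr x).
Definition quot_mul (x y : quot_alg) := to_quot (repr x * repr y).
Definition quot_scale (k : K) (x : quot_alg) := to_quot (k *: repr x).

Lemma quot_addE a b : quot_add (to_quot a) (to_quot b) = to_quot (a + b).
Proof.
apply/to_quotP; rewrite opprD addrACA.
by apply: rel_idealD; apply: repr_to_quot.
Qed.
Lemma quot_oppE a : quot_opp (to_quot a) = to_quot (- a).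
Proof. by apply/to_quotP; rewrite -opprD; apply/rel_idealN/repr_to_quot. Qed.
Lemma quot_mulE a b : quot_mul (to_quot a) (to_quot b) = to_quot (a * b).
Proof.
apply/to_quotP.
set a' := repr _; set b' := repr _.
have -> : a' * b' - a * b = a' * (b' - b) + (a' - a) * b.
  by rewrite mulrBr mulrBl addrA subrK.
by apply: rel_idealD; [apply: rel_idealMl|apply: rel_idealMr];
  apply: repr_to_quot.
Qed.
Lemma quot_scaleE k a : quot_scale k (to_quot a) = to_quot (k *: a).
Proof.
apply/to_quotP; rewrite -scalerBr -mulr_algl.
exact/rel_idealMl/repr_to_quot.
Qed.

Lemma quotW (P : quot_alg -> Prop) : (forall a, P (to_quot a)) -> forall x, P x.
Proof. by move=> PA x; rewrite -[x]to_quot_repr. Qed.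

Let quotE := (quot_addE, quot_oppE, quot_mulE, quot_scaleE).

Fact quot_addA : associative quot_add.
Proof. by do 3 elim/quotW => ?; rewrite !quotE addrA. Qed.
Fact quot_addC : commutative quot_add.
Proof. by do 2 elim/quotW => ?; rewrite !quotE addrC. Qed.
Fact quot_add0 : left_id (to_quot 0) quot_add.
Proof. by elim/quotW => ?; rewrite !quotE add0r. Qed.
Fact quot_addN : left_inverse (to_quot 0) quot_opp quot_add.
Proof. by elim/quotW => ?; rewrite !quotE addNr. Qed.
HB.instance Definition _ := GRing.isZmodule.Build quot_alg
  quot_addA quot_addC quot_add0 quot_addN.

Fact quot_mulA : associative quot_mul.
Proof. by do 3 elim/quotW => ?; rewrite !quotE mulrA. Qed.
Fact quot_mul1 : left_id (to_quot 1) quot_mul.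
Proof. by elim/quotW => ?; rewrite !quotE mul1r. Qed.
Fact quot_mulr1 : right_id (to_quot 1) quot_mul.
Proof. by elim/quotW => ?; rewrite !quotE mulr1. Qed.
Fact quot_mulDl : left_distributive quot_mul quot_add.
Proof. by do 3 elim/quotW => ?; rewrite !quotE mulrDl. Qed.
Fact quot_mulDr : right_distributive quot_mul quot_add.
Proof. by do 3 elim/quotW => ?; rewrite !quotE mulrDr. Qed.
HB.instance Definition _ := GRing.Zmodule_isPzRing.Build quot_alg
  quot_mulA quot_mul1 quot_mulr1 quot_mulDl quot_mulDr.

Fact quot_scaleA k l x : quot_scale k (quot_scale l x) = quot_scale (k * l) x.
Proof. by elim/quotW: x => ?; rewrite !quotE scalerA. Qed.
Fact quot_scale1 : left_id 1 quot_scale.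
Proof. by elim/quotW => ?; rewrite !quotE scale1r. Qed.
Fact quot_scaleDr : right_distributive quot_scale quot_add.
Proof. by move=> ?; do 2 elim/quotW => ?; rewrite !quotE scalerDr. Qed.
Fact quot_scaleDl x : {morph quot_scale^~ x : k l / k + l >-> quot_add k l}.
Proof. by move=> ? ?; elim/quotW: x => ?; rewrite !quotE scalerDl. Qed.
HB.instance Definition _ := GRing.Zmodule_isLmodule.Build K quot_alg
  quot_scaleA quot_scale1 quot_scaleDr quot_scaleDl.

Fact quot_scaleAl k (x y : quot_alg) : k *: (x * y) = (k *: x) * y.
Proof.
elim/quotW: x => a; elim/quotW: y => b.
by rewrite -[LHS]/(quot_scale _ (quot_mul _ _))
  -[RHS]/(quot_mul (quot_scale _ _) _) !quotE scalerAl.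
Qed.

Fact quot_scaleAr k (x y : quot_alg) : k *: (x * y) = x * (k *: y).
Proof.
elim/quotW: x => a; elim/quotW: y => b.
by rewrite -[LHS]/(quot_scale _ (quot_mul _ _))
  -[RHS]/(quot_mul _ (quot_scale _ _)) !quotE scalerAr.
Qed.

End QuotientAlgebra.

Section FreeAlgebra.
Variables (K : comNzRingType) (I : choiceType).

Definition free_alg := {malg K[{fmonom I}]}.
HB.instance Definition _ := GRing.Lalgebra.on free_alg.

Fact free_scaleAr (k : K) (a b : free_alg) : k *: (a * b) = a * (k *: b).
Proof.
have mulC (g : {malg K[{fmonom I}]}) : g * k%:MP = k *: g.
  rewrite malgM_def malgZ_def fgmulgU.
  by apply: eq_bigr => m _; rewrite mulm1 mulrC.
have Z (x y : {malg K[{fmonom I}]}) : k *: (x * y) = x * (k *: y).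
  by rewrite -[k *: y]mul_malgC mulrA mulC scalerAl.
exact: Z.
Qed.
HB.instance Definition _ := GRing.LSemiAlgebra_isSemiAlgebra.Build K free_alg
  free_scaleAr.

Definition free_gen (i : I) : free_alg := << fmu i >>.

End FreeAlgebra.

Section QuantumScalars.
Variables (K : fieldType) (q : K).

Definition qint (n : int) : K := (q ^ n - q ^ (- n)) / (q - q^-1).

Definition qfact (n : nat) : K := \prod_(1 <= i < n.+1) qint i%:Z.

(* Membership in the subring Z[q, q^-1] of K. *)
Definition is_int_laurent (a : K) : Prop :=
  exists (p : {poly int}) (k : nat), a = (map_poly intr p).[q] / q ^+ k.

(* A tuple (m_n, ..., m_1) is the sequence s listing its entries in that
   order, so that m_i is [nth 0 s (n - i)].  For sorted s, [mults s] is
   (l_1, ..., l_j). *)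

Definition mults (s : seq nat) : seq nat := [seq count_mem m s | m <- undup s].

(* On sorted s the subtraction of naturals does not truncate and the halving
   is exact. *)
Definition qexp (s : seq nat) : nat :=
  let n := size s in
  (\sum_(1 <= i < n.+1) 2 * (i - 1) * nth 0 s (n - i)
   + (n * (n - 1) - \sum_(l <- mults s) l * (l - 1))./2)%N.

Definition ccoef (s : seq nat) : K :=
  qfact (size s) / (\prod_(l <- mults s) qfact l) * q ^+ qexp s.

End QuantumScalars.

Inductive Ugen : Type :=
| gX of int
| gY of int
| gH of {k : int | k != 0}
| gK | gKinv
| gC | gCinv. (* c^{1/2} and c^{-1/2} *)

HB.instance Definition _ := gen_eqMixin Ugen.
HB.instance Definition _ := gen_choiceMixin Ugen.

(* The algebra \hat U_q over a field K with a parameter q in K; the case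
   K = C(q), with q the indeterminate, is below.  The relations are stated for
   the values [gen] of the generators in an arbitrary algebra. *)

Section Relations.
Variables (K : fieldType) (q : K) (A : lalgType K) (gen : Ugen -> A).

Local Notation "[ n ]q" := (qint q n).

Definition gx (n : int) : A := gen (gX n).
Definition gy (n : int) : A := gen (gY n).
(* There is no generator h_0; the value at 0 is never used. *)
Definition gh (k : int) : A :=
  if insub k is Some k' then gen (gH k') else 0.
Definition gk : A := gen gK.
Definition gkinv : A := gen gKinv.

(* gc k = c^{k/2} *)
Definition gc (k : int) : A :=
  match k with
  | Posz n => gen gC ^+ n
  | Negz n => gen gCinv ^+ n.+1
  end.

(* \sum_{m >= 0} psi_m z^-m, in the variable z^-1 *)
Definition psi_series : fps A :=
  fpsC gk * fps_exp (Fps (fun m => if m == 0%N then 0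
                                   else (q - q^-1) *: gh m%:Z)).

(* \sum_{m >= 0} phi_{-m} z^m, in the variable z *)
Definition phi_series : fps A :=
  fpsC gkinv * fps_exp (Fps (fun m => if m == 0%N then 0
                                      else (- (q - q^-1)) *: gh (- m%:Z))).

Definition psi (m : int) : A := if 0 <= m then psi_series `|m|%N else 0.
Definition phi (m : int) : A := if m <= 0 then phi_series `|m|%N else 0.

Definition commutator (a b : A) : A := a * b - b * a.

Inductive Urel : A -> A -> Prop :=
| rel_KKinv : Urel (gk * gkinv) 1
| rel_KinvK : Urel (gkinv * gk) 1
| rel_CCinv : Urel (gc 1 * gc (-1)) 1
| rel_CinvC : Urel (gc (-1) * gc 1) 1
| rel_C_central a : Urel (gc 1 * a) (a * gc 1)
| rel_hh (m n : int) : m != 0 -> n != 0 ->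
    Urel (commutator (gh m) (gh n))
      (if m == - n
       then ([2 * m]q / m%:~R / (q - q^-1)) *: (gc (2 * m) - gc (- (2 * m)))
       else 0)
| rel_Kh (m : int) : m != 0 -> Urel (gk * gh m) (gh m * gk)
| rel_Kx (m : int) : Urel (gk * gx m * gkinv) (q ^+ 2 *: gx m)
| rel_Ky (m : int) : Urel (gk * gy m * gkinv) (q ^- 2 *: gy m)
| rel_hx (m n : int) : m != 0 ->
    Urel (commutator (gh m) (gx n))
      (([2 * m]q / m%:~R) *: (gc (- `|m|) * gx (m + n)))
| rel_hy (m n : int) : m != 0 ->
    Urel (commutator (gh m) (gy n))
      (- ([2 * m]q / m%:~R) *: (gc `|m| * gy (m + n)))
| rel_xx (m n : int) :
    Urel (gx (m + 1) * gx n - q ^+ 2 *: (gx n * gx (m + 1)))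
      (q ^+ 2 *: (gx m * gx (n + 1)) - gx (n + 1) * gx m)
| rel_yy (m n : int) :
    Urel (gy (m + 1) * gy n - q ^- 2 *: (gy n * gy (m + 1)))
      (q ^- 2 *: (gy m * gy (n + 1)) - gy (n + 1) * gy m)
| rel_xy (m n : int) :
    Urel (commutator (gx m) (gy n))
      ((q - q^-1)^-1 *: (gc (m - n) * psi (m + n) - gc (- (m - n)) * phi (m + n))).

(* The augmentation killing x_n, y_n, h_k and sending K and c^{1/2} to 1 is
   compatible with the relations, so that 1 != 0 in the presented algebra. *)

Definition aug_gen (g : Ugen) : K :=
  match g with gX _ | gY _ | gH _ => 0 | _ => 1 end.

Section Augmentation.
Variable eps : A -> K.
Hypothesis epsB : zmod_morphism eps.
Hypothesis epsM : {morph eps : a b / a * b}.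
Hypothesis eps1 : eps 1 = 1.
Hypothesis epsZ : forall k a, eps (k *: a) = k * eps a.
Hypothesis eps_gen : forall g, eps (gen g) = aug_gen g.

Let eps0 : eps 0 = 0. Proof. by rewrite -(subrr 0) epsB subrr. Qed.
Let epsD a b : eps (a + b) = eps a + eps b.
Proof. by rewrite -[b in LHS]opprK -(sub0r b) !epsB eps0 sub0r opprK. Qed.
Let eps_sum n (f : nat -> A) :
  eps (\sum_(i < n) f i) = \sum_(i < n) eps (f i).
Proof. exact: (big_morph eps epsD eps0). Qed.
Let epsX a n : eps (a ^+ n) = eps a ^+ n.
Proof. by elim: n => [|n IH]; rewrite ?expr0 ?eps1 // !exprS epsM IH. Qed.

Let eps_x n : eps (gx n) = 0. Proof. exact: eps_gen. Qed.
Let eps_y n : eps (gy n) = 0. Proof. exact: eps_gen. Qed.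
Let eps_h n : eps (gh n) = 0.
Proof. by rewrite /gh; case: insubP => *; rewrite ?eps_gen ?eps0. Qed.
Let eps_K : eps gk = 1. Proof. exact: eps_gen. Qed.
Let eps_Kinv : eps gkinv = 1. Proof. exact: eps_gen. Qed.
Let eps_c k : eps (gc k) = 1.
Proof. by case: k => n; rewrite /gc epsX eps_gen expr1n. Qed.

Let eps_exp (a : A) (f : fps A) k : (forall i, eps (f i) = 0) ->
  eps ((fpsC a * fps_exp f) k) = eps a * (k == 0%N)%:R.
Proof.
move=> f0; have fS j i : eps ((f ^+ j.+1) i) = 0.
  rewrite exprS /= (eps_sum _ (fun l => f l * (f ^+ j) (i - l)%N)) big1 // => l _.
  by rewrite epsM f0 mul0r.
rewrite [LHS](eps_sum _ (fun l => fpsC a l * fps_exp f (k - l)%N)) big_ord_recl big1 ?addr0 => [|l _]; last first.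
  by rewrite epsM /= eps0 mul0r.
rewrite epsM subn0 /=; congr (_ * _).
rewrite (eps_sum _ (fun j => (j`!%:R)^-1 *: (f ^+ j) k)) big_ord_recl big1 ?addr0 => [|l _]; last first.
  by rewrite epsZ fS mulr0.
rewrite epsZ fact0 invr1 mul1r expr0 /=.
by case: eqP => _; rewrite ?eps1 ?eps0.
Qed.

Let eps_psi m : eps (psi m) = (m == 0)%:R.
Proof.
have f0 i : eps (if i == 0%N then 0 else (q - q^-1) *: gh i%:Z) = 0.
  by case: eqP => _; rewrite ?eps0 // epsZ eps_h mulr0.
rewrite /psi; case: m => m /=; last exact: eps0.
by rewrite eps_exp // eps_K mul1r.
Qed.

Let eps_phi m : eps (phi m) = (m == 0)%:R.
Proof.
have f0 i : eps (if i == 0%N then 0 else - (q - q^-1) *: gh (- i%:Z)) = 0.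
  by case: eqP => _; rewrite ?eps0 // epsZ eps_h mulr0.
rewrite /phi; case: m => [[|m]|m] /=; last 2 first.
- exact: eps0.
- by rewrite eps_exp // eps_Kinv mul1r.
by rewrite eps_exp // eps_Kinv mul1r.
Qed.

Lemma aug_Urel a b : Urel a b -> eps a = eps b.
Proof.
have epsC a' b' : eps (commutator a' b') = 0.
  by rewrite epsB !epsM mulrC subrr.
case=> *; rewrite ?epsC ?(epsB, epsM, epsZ, eps1)
  ?(eps_x, eps_y, eps_h, eps_K, eps_Kinv, eps_c, eps_psi, eps_phi)
  ?(mul0r, mulr0, mul1r, mulr1, subrr) //.
by case: ifP => _; rewrite ?eps0 // epsZ epsB !eps_c subrr mulr0.
Qed.

Lemma aug_ideal a : rel_ideal Urel a -> eps a = 0.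
Proof.
elim=> [{}a b /aug_Urel ab||{}a b _ a0 _ b0|{}a b _ b0|{}a b _ a0].
- by rewrite epsB ab subrr.
- exact: eps0.
- by rewrite epsD a0 b0 addr0.
- by rewrite epsM b0 mulr0.
- by rewrite epsM a0 mul0r.
Qed.

End Augmentation.

End Relations.

Section Algebra.
Variables (K : fieldType) (q : K).

Local Notation F := (free_alg K Ugen).

Definition Uhat := quot_alg (Urel q (@free_gen K Ugen)).
HB.instance Definition _ := GRing.Lmodule.on Uhat.
HB.instance Definition _ := GRing.PzRing.on Uhat.

Definition aug_mon (m : {fmonom Ugen}) : K := \prod_(g <- m) aug_gen K g.

Fact aug_mon_morph : mmorphism aug_mon.
Proof.
split=> [m n|]; rewrite /aug_mon; first by rewrite fmM big_cat.
by rewrite fm1 big_nil.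
Qed.
HB.instance Definition _ := isMultiplicative.Build _ _ aug_mon aug_mon_morph.

Definition aug (a : F) : K := mmap idfun aug_mon a.

Fact aug_free_gen g : aug (free_gen K g) = aug_gen K g.
Proof. by rewrite /aug /free_gen mmapU mul1r /= /aug_mon fmU big_seq1. Qed.

Fact Uhat_oner_neq0 : (1 : Uhat) != 0.
Proof.
have aug1 : aug 1 = 1 by exact: (rmorph1 (mmap idfun aug_mon)).
apply/eqP => /to_quotP I1; have : aug (1 - 0) = 0.
  apply: (aug_ideal _ _ aug1 _ aug_free_gen I1).
  - exact: mmapB.
  - exact: (rmorphM (mmap idfun aug_mon)).
  - exact: mmap_is_linear.
by rewrite subr0 aug1; apply/eqP/oner_neq0.
Qed.

HB.instance Definition _ := GRing.PzSemiRing_isNonZero.Build Uhat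
  Uhat_oner_neq0.
HB.instance Definition _ := GRing.LSemiModule_isLSemiAlgebra.Build K Uhat
  (@quot_scaleAl _ _ _).
HB.instance Definition _ := GRing.LSemiAlgebra_isSemiAlgebra.Build K Uhat
  (@quot_scaleAr _ _ _).

Definition Ugenerator (g : Ugen) : Uhat := to_quot _ (free_gen K g).
Definition Ux (n : int) : Uhat := Ugenerator (gX n).
Definition Uy (n : int) : Uhat := Ugenerator (gY n).

(* X_0^+(z) and Y_0^+(z), in the variable z^-1 *)
Definition Xplus : fps Uhat := Fps (fun k => Ux k%:Z).
Definition Yplus : fps Uhat := Fps (fun k => Uy k%:Z).

End Algebra.

(* The field C(q), with C = R[i] the complex numbers over R. *)
Definition Cq (R : realType) := {fraction {poly R[i]}}.
HB.instance Definition _ (R : realType) := GRing.Field.on (Cq R).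

Definition qvar (R : realType) : Cq R := tofrac 'X.

(* Main.v *)
From HB Require Import structures.
Require Import Defs.
From mathcomp Require Import all_boot all_order all_algebra.
From mathcomp Require Import complex ring zify.
From mathcomp Require Import boolp classical_sets cardinality fsbigop reals.

(** Write S for X_0^+(z), A = x_0 for its constant term and B = S - A for the
    rest.  Summing the quadratic relation of the x_m over all the pairs of
    indices that contribute to one power of z gives T = - T for the
    coefficient T of B S - q^2 S B; the scalars have characteristic 0, so
    B S = q^2 S B ([tail_qcomm]).  From this relation alone a q-binomial
    theorem with p = q^2 follows ([qbinomial]):

      S^n = sum_l [n choose l]_p p^(m(m-1)/2) A^l B^m,   m = n - l.

    Moreover B is z^-1 times the same kind of series for the shifted family
    m |-> x_(m+1), which satisfies the same quadratic relation.  Hence B^m can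
    be expanded in turn.  On the other side, a nondecreasing sequence s is
    uniquely l zeros followed by a nondecreasing sequence t of size m with all
    entries increased by one, and the numbers c_s of the theorem satisfy the
    matching recursion ([ccoef_zeros_cons])

      c_s = [n choose l]_p p^(m(m-1)/2) c_t.

    So both sides agree by induction on n plus the power of z
    ([coef_expr_sorted]).  The same recursion shows that every c_s is
    a product of Gauss binomials and powers of q, hence a Laurent polynomial
    with integer coefficients ([is_int_laurent_ccoef]).

    For Y_0^+(z), multiply the relation of the y_m by - q^2 and read products
    from right to left: it becomes the relation of the x_m.  The formula is
    therefore the one above in the converse algebra ([Uy_quadratic_rel]). *)

Set Implicit Arguments.
Unset Strict Implicit.
Unset Printing Implicit Defensive.

Import GRing.Theory.

Local Open Scope ring_scope.

(** * Gauss binomials and the q-binomial theorem *)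
Section GaussBinomial.
Variables (K : comNzRingType) (p : K).

Fixpoint gauss_binom (n l : nat) : K :=
  match n, l with
  | _, 0 => 1
  | 0, _.+1 => 0
  | n'.+1, l'.+1 => p ^+ (n' - l') * gauss_binom n' l' + gauss_binom n' l
  end.

Lemma gauss_binom0 n : gauss_binom n 0 = 1.
Proof. by case: n. Qed.

Lemma gauss_binomS n l :
  gauss_binom n.+1 l.+1
  = p ^+ (n - l) * gauss_binom n l + gauss_binom n l.+1.
Proof. by []. Qed.

Lemma gauss_binom_small n l : (n < l)%N -> gauss_binom n l = 0.
Proof.
elim: n l => [|n IHn] [|l] //; rewrite ltnS => lt_nl /=.
by rewrite !IHn ?mulr0 ?addr0 // ltnW.
Qed.

Lemma qcomm_expr (A : algType K) (a b : A) n :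
  a * b = p *: (b * a) -> a ^+ n * b = p ^+ n *: (b * a ^+ n).
Proof.
move=> ab; elim: n => [|n IHn]; first by rewrite !expr0 mul1r mulr1 scale1r.
rewrite [a ^+ _]exprSr -mulrA ab -scalerAr [a ^+ n * (_ * _)]mulrA IHn.
by rewrite -scalerAl scalerA -exprS mulrA.
Qed.

(** Induction on [n], multiplying by [a + b] on the right: moving [a + b] to
    the left of [b ^+ m] costs [p ^+ m], because [b] and [a + b], unlike
    [b] and [a], commute up to the scalar [p].  The coefficients then satisfy
    exactly the Pascal rule that defines [gauss_binom]. *)
Lemma qbinomial (A : algType K) (a b : A) n :
  b * (a + b) = p *: ((a + b) * b) ->
  (a + b) ^+ n = \sum_(l < n.+1)
    (gauss_binom n l * p ^+ 'C(n - l, 2)) *: (a ^+ l * b ^+ (n - l)).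
Proof.
move=> ab; elim: n => [|n IHn].
  by rewrite big_ord1 !expr0 !mulr1 scale1r.
(* The factor p ^+ (n - l) is the price of moving a + b past b ^+ (n - l). *)
pose G l := gauss_binom n l * p ^+ ('C(n - l, 2) + (n - l)).
transitivity (\sum_(l < n.+1) G l *: (a ^+ l.+1 * b ^+ (n - l))
  + \sum_(l < n.+1) G l *: (a ^+ l * b ^+ (n - l).+1)).
  rewrite exprSr IHn mulr_suml -big_split; apply: eq_bigr => l _ /=.
  rewrite -scalerAl -mulrA (qcomm_expr _ ab) -scalerAr scalerA -mulrA -exprD.
  by rewrite mulrDl mulrDr scalerDr -exprS !mulrA -exprSr.
rewrite [RHS]big_ord_recl addrC [X in X + _]big_ord_recl -addrA.
congr (_ + _); first by rewrite /G !gauss_binom0 !subn0 binS bin1.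
have -> : \sum_(i < n) G (lift ord0 i)
      *: (a ^+ lift ord0 i * b ^+ (n - lift ord0 i).+1)
    = \sum_(i < n.+1) (gauss_binom n i.+1 * p ^+ 'C(n - i, 2))
      *: (a ^+ i.+1 * b ^+ (n - i)).
  rewrite [RHS]big_ord_recr gauss_binom_small // mul0r scale0r Monoid.mulm1.
  apply: eq_bigr => i _; rewrite lift0 /G.
  by rewrite -[in RHS](subnSK (ltn_ord i)) binS bin1 subnSK.
rewrite -big_split; apply: eq_bigr => i _.
rewrite lift0 gauss_binomS subSS /= -scalerDl; congr (_ *: _).
by rewrite /G exprD; ring.
Qed.

End GaussBinomial.

(** * Formal power series and converse rings as algebras *)
Section FpsAlgebra.
Variables (K : comNzRingType) (A : algType K).

Fact fps_oner_neq0 : (1 : fps A) != 0.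
Proof.
by apply/eqP => /(congr1 (fun f : fps A => f 0%N))/eqP; rewrite oner_eq0.
Qed.
HB.instance Definition _ :=
  GRing.PzSemiRing_isNonZero.Build (fps A) fps_oner_neq0.

Definition fps_scale (c : K) (f : fps A) : fps A := Fps (fun k => c *: f k).

Fact fps_scaleA c d f : fps_scale c (fps_scale d f) = fps_scale (c * d) f.
Proof. by apply: fpsP => k /=; rewrite scalerA. Qed.
Fact fps_scale1 : left_id 1 fps_scale.
Proof. by move=> f; apply: fpsP => k /=; rewrite scale1r. Qed.
Fact fps_scaleDr : right_distributive fps_scale +%R.
Proof. by move=> c f g; apply: fpsP => k /=; rewrite scalerDr. Qed.
Fact fps_scaleDl f : {morph fps_scale^~ f : c d / c + d}.
Proof. by move=> c d; apply: fpsP => k /=; rewrite scalerDl. Qed.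
HB.instance Definition _ := GRing.Zmodule_isLmodule.Build K (fps A)
  fps_scaleA fps_scale1 fps_scaleDr fps_scaleDl.

Fact fps_scaleAl c (f g : fps A) : c *: (f * g) = (c *: f) * g.
Proof.
apply: fpsP => k /=; rewrite scaler_sumr.
by apply: eq_bigr => i _; rewrite scalerAl.
Qed.
Fact fps_scaleAr c (f g : fps A) : c *: (f * g) = f * (c *: g).
Proof.
apply: fpsP => k /=; rewrite scaler_sumr.
by apply: eq_bigr => i _; rewrite scalerAr.
Qed.
HB.instance Definition _ :=
  GRing.LSemiModule_isLSemiAlgebra.Build K (fps A) fps_scaleAl.
HB.instance Definition _ :=
  GRing.LSemiAlgebra_isSemiAlgebra.Build K (fps A) fps_scaleAr.

End FpsAlgebra.

Section ConverseAlgebra.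
Variables (K : comNzRingType) (A : algType K).

HB.instance Definition _ := GRing.Nmodule_isLSemiModule.Build K A^c
  (@scalerA K A) (@scale0r K A) (@scale1r K A) (@scalerDr K A) (@scalerDl K A).
HB.instance Definition _ :=
  GRing.LSemiModule_isLSemiAlgebra.Build K A^c
    (fun c a b => @scalerAr K A c b a).
HB.instance Definition _ :=
  GRing.LSemiAlgebra_isSemiAlgebra.Build K A^c
    (fun c a b => @scalerAl K A c b a).

End ConverseAlgebra.

(** * Multiplication of a power series by its variable *)
Section FpsShift.
Variables (K : comNzRingType) (A : algType K).
Implicit Types f g : fps A.

Definition fps_shift f : fps A :=
  Fps (fun k => if k is k'.+1 then f k' else 0).

Lemma fps_shiftMl f g : fps_shift f * g = fps_shift (f * g).
Proof.
apply: fpsP => -[|k] /=; first by rewrite big_ord1 mul0r.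
by rewrite big_ord_recl mul0r add0r.
Qed.

Lemma fps_shiftMr f g : f * fps_shift g = fps_shift (f * g).
Proof.
apply: fpsP => -[|k] /=; first by rewrite big_ord1 mulr0.
rewrite big_ord_recr /= subnn mulr0 addr0; apply: eq_bigr => i _.
by rewrite subSn // -ltnS.
Qed.

Lemma fps_shiftX f m : fps_shift f ^+ m = iter m fps_shift (f ^+ m).
Proof.
elim: m => [|m IHm]; first by rewrite !expr0.
rewrite !exprS IHm fps_shiftMl; congr fps_shift.
elim: m {IHm} (f ^+ m) => //= m IHm g.
by rewrite fps_shiftMr IHm.
Qed.

Lemma coef_iter_shift f m k :
  iter m fps_shift f k = if (m <= k)%N then f (k - m)%N else 0.
Proof.
elim: m k => [|m IHm] k /=; first by rewrite subn0.
by case: k => [|k] //; rewrite IHm ltnS subSS.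
Qed.

Lemma coef_fpsCM (a : A) f k : (fpsC a * f) k = a * f k.
Proof.
rewrite /= big_ord_recl subn0 big1 ?addr0 // => i _.
by rewrite mul0r.
Qed.

Lemma fpsCX (a : A) n : fpsC a ^+ n = fpsC (a ^+ n).
Proof.
elim: n => [|n IHn]; first by rewrite !expr0.
apply: fpsP => k; rewrite exprS IHn coef_fpsCM exprS.
by rewrite /=; case: eqP => _; rewrite ?mulr0.
Qed.

Lemma coef_fps_sum (I : Type) (r : seq I) (F : I -> fps A) k :
  (\sum_(i <- r) F i) k = \sum_(i <- r) F i k.
Proof. exact: (big_morph (fun f : fps A => f k)). Qed.

Lemma fps_head_tail (x : nat -> A) :
  Fps x = fpsC (x 0%N) + fps_shift (Fps (x \o S)).
Proof. by apply: fpsP => -[|k] /=; rewrite ?addr0 ?add0r. Qed.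

End FpsShift.

(** * The quadratic relation and its consequence for a current *)
Section QuadraticRelation.
Variables (K : fieldType) (q : K) (A : algType K).

Definition quadratic_rel (x : nat -> A) : Prop := forall m n,
  x m.+1 * x n - q ^+ 2 *: (x n * x m.+1)
  = q ^+ 2 *: (x m * x n.+1) - x n.+1 * x m.

(** This lets the expansion be iterated: the tail of a current is again, up to
    a power of the variable, a current for the same relation. *)
Lemma quadratic_relS x : quadratic_rel x -> quadratic_rel (x \o S).
Proof. by move=> xP m n; apply: xP. Qed.

(** In each degree, summing the relation over all pairs of indices that
    contribute makes its right side the opposite of its left side, after
    reversal of the order of summation; so twice the left side vanishes. *)
Lemma tail_qcomm x : 2%:R != 0 :> K -> quadratic_rel x ->
  fps_shift (Fps (x \o S)) * Fps x
  = q ^+ 2 *: (Fps x * fps_shift (Fps (x \o S))).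
Proof.
move=> nz2 xP; rewrite fps_shiftMl fps_shiftMr.
apply: fpsP => -[|k]; first by rewrite /= scaler0.
rewrite -[LHS]/(\sum_(i < k.+1) x i.+1 * x (k - i)%N).
rewrite -[RHS]/(q ^+ 2 *: fps_mul (Fps x) (Fps (x \o S)) k) fps_mul_rev /=.
apply/eqP; rewrite -subr_eq0 scaler_sumr -sumrB.
set T := \sum_(i < _) _.
have TN : T = - T.
  rewrite {2}/T (reindex_inj rev_ord_inj) /= /T -sumrN.
  apply: eq_bigr => i _; rewrite subSS subKn ?leq_ord // opprB.
  by rewrite xP.
have : 2%:R *: T = 0 by rewrite scaler_nat mulr2n {2}TN subrr.
by move/eqP; rewrite scaler_eq0 (negPf nz2).
Qed.

Lemma coef_expr_recursion x n k : 2%:R != 0 :> K -> quadratic_rel x ->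
  (Fps x ^+ n) k = \sum_(l < n.+1)
    (gauss_binom (q ^+ 2) n l * (q ^+ 2) ^+ 'C(n - l, 2)) *:
    (x 0%N ^+ l * (if (n - l <= k)%N
                   then (Fps (x \o S) ^+ (n - l)) (k - (n - l))%N else 0)).
Proof.
move=> nz2 xP; have := tail_qcomm nz2 xP.
rewrite (fps_head_tail x) => /qbinomial ->.
rewrite coef_fps_sum; apply: eq_bigr => l _.
by rewrite fpsCX fps_shiftX -coef_iter_shift -coef_fpsCM.
Qed.

End QuadraticRelation.

(** * Nondecreasing sequences with given length and sum *)
Section SortedSequences.

Fixpoint compositions (n k : nat) : seq (seq nat) :=
  if n is n'.+1 then
    [seq i :: s | i <- iota 0 k.+1, s <- compositions n' (k - i)]
  else if k is 0 then [:: [::]] else [::].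

Lemma mem_compositions n k s :
  (s \in compositions n k) = (size s == n) && (sumn s == k).
Proof.
elim: n k s => [|n IHn] k s.
  by case: s => [|i s]; case: k.
apply/(allpairsPdep (s := iota 0 k.+1))/andP => [[i [t [+ + ->]]]|[]].
  rewrite mem_iota IHn /= ltnS => le_ik /andP[/eqP-> /eqP->].
  by rewrite subnKC.
case: s => [|i s] // /eqP[sz_s] /eqP <-; exists i, s.
by rewrite mem_iota /= IHn sz_s addKn ltnS leq_addr !eqxx.
Qed.

Lemma compositions_uniq n k : uniq (compositions n k).
Proof.
elim: n k => [|n IHn] k; first by case: k.
apply: allpairs_uniq_dep => //; first exact: iota_uniq.
by move=> [i s] [j t] _ _ /= [-> ->].
Qed.

Definition sorted_seqs n k := [seq s <- compositions n k | sorted leq s].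

Lemma mem_sorted_seqs n k s :
  (s \in sorted_seqs n k) = [&& sorted leq s, size s == n & sumn s == k].
Proof. by rewrite mem_filter mem_compositions. Qed.

Lemma sorted_seqs_uniq n k : uniq (sorted_seqs n k).
Proof. exact/filter_uniq/compositions_uniq. Qed.

(** Every nondecreasing sequence has this form in exactly one way, which
    matches the term of index [l] in the q-binomial expansion: the zeros come
    from the constant term of the current, the rest from its tail. *)
Definition zeros_cons (l : nat) (t : seq nat) := nseq l 0%N ++ map S t.

Lemma size_zeros_cons l t : size (zeros_cons l t) = (l + size t)%N.
Proof. by rewrite size_cat size_nseq size_map. Qed.

Lemma sumn_zeros_cons l t : sumn (zeros_cons l t) = (size t + sumn t)%N.
Proof.
rewrite sumn_cat sumn_nseq mul0n add0n.
by elim: t => //= m t ->; lia.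
Qed.

Lemma sorted_zeros_cons l t : sorted leq (zeros_cons l t) = sorted leq t.
Proof.
have sortS u : sorted leq (map S u) = sorted leq u by rewrite sorted_map.
rewrite -[RHS]sortS /zeros_cons; elim: l => //= l <-.
by case: (_ ++ _) => //= i s; rewrite leq0n.
Qed.

Lemma count0_zeros_cons l t : count_mem 0%N (zeros_cons l t) = l.
Proof.
rewrite count_cat count_nseq mul1n count_map (eq_count (a2 := pred0)) //.
by rewrite count_pred0 addn0.
Qed.

Lemma zeros_cons_inj l1 t1 l2 t2 :
  zeros_cons l1 t1 = zeros_cons l2 t2 -> (l1, t1) = (l2, t2).
Proof.
move=> e; have El : l1 = l2.
  by rewrite -(count0_zeros_cons l1 t1) e count0_zeros_cons.
move: e; rewrite El => /eqP; rewrite eqseq_cat ?size_nseq // eqxx /=.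
by move=> /eqP/(inj_map succn_inj) ->.
Qed.

Lemma sorted_zeros_consP s : sorted leq s -> exists l t, s = zeros_cons l t.
Proof.
elim: s => [|[|m] s IHs] /= ss; first by exists 0%N, [::].
  by have [l [t ->]] := IHs (path_sorted ss); exists l.+1, t.
exists 0%N, (map predn (m.+1 :: s)).
rewrite /zeros_cons /= -map_comp -[LHS]map_id; congr (_ :: _).
apply/eq_in_map => i si /=; rewrite prednK //.
by have /allP/(_ i si) := order_path_min leq_trans ss; apply: leq_ltn_trans.
Qed.

(** Well founded because passing from [zeros_cons l t] to [t] decreases the
    length plus the sum by [l + size t], which is positive unless both
    sequences are empty. *)
Lemma sorted_zeros_ind (P : seq nat -> Prop) :
  P [::] ->
  (forall l t, sorted leq t -> P t -> P (zeros_cons l t)) ->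
  forall s, sorted leq s -> P s.
Proof.
move=> P0 PS s; have [N] := ubnP (size s + sumn s).
elim: N s => // N IHN s lt_sN ss; case: (eqVneq s [::]) => [-> //|s_neq0].
have [l [t def_s]] := sorted_zeros_consP ss.
have st : sorted leq t by rewrite -(sorted_zeros_cons l) -def_s.
rewrite def_s; apply: PS => //; apply: IHN => //; move: lt_sN.
have : (0 < size s)%N by rewrite lt0n size_eq0.
by rewrite def_s size_zeros_cons sumn_zeros_cons; lia.
Qed.

Lemma sorted_seqs_split n k :
  perm_eq (sorted_seqs n k)
    [seq zeros_cons l t | l <- iota 0 n.+1,
       t <- if (n - l <= k)%N then sorted_seqs (n - l) (k - (n - l)) else [::]].
Proof.
apply: uniq_perm; first exact: sorted_seqs_uniq.
  apply: allpairs_uniq_dep => [|l _|]; first exact: iota_uniq.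
    by case: ifP => // _; apply: sorted_seqs_uniq.
  by move=> [l1 t1] [l2 t2] _ _ /= /zeros_cons_inj [-> ->].
move=> s; rewrite mem_sorted_seqs.
apply/and3P/allpairsPdep => [[ss /eqP ns /eqP ks]|[l [t []]]].
  have [l [t def_s]] := sorted_zeros_consP ss; exists l, t.
  move: ss ns ks; rewrite def_s sorted_zeros_cons size_zeros_cons.
  rewrite sumn_zeros_cons => st <- <-; split=> //.
    by rewrite mem_iota ltnS leq_addr.
  by rewrite addKn leq_addr mem_sorted_seqs st addKn !eqxx.
rewrite mem_iota ltnS => le_ln; case: ifP => // le_k.
rewrite mem_sorted_seqs => /and3P[st /eqP nt /eqP kt] ->.
by rewrite sorted_zeros_cons size_zeros_cons sumn_zeros_cons nt kt !subnKC.
Qed.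

Lemma sum_sorted_seqs (V : nmodType) (f : seq nat -> V) n k :
  \sum_(s <- sorted_seqs n k) f s = \sum_(l < n.+1)
    if (n - l <= k)%N then
      \sum_(t <- sorted_seqs (n - l) (k - (n - l))) f (zeros_cons l t)
    else 0.
Proof.
rewrite (perm_big _ (sorted_seqs_split n k)) big_allpairs_dep.
rewrite -[iota 0 n.+1]/(index_iota 0 n.+1) big_mkord; apply: eq_bigr => l _.
by case: ifP => // _; rewrite big_nil.
Qed.

End SortedSequences.

(** * Gauss binomials as quotients of quantum factorials *)
Section QuantumIntegers.
Variables (K : fieldType) (q : K).
Hypothesis qint_neq0 : forall n : nat, qint q n.+1%:Z != 0.

Lemma q_neq0_of_qint_neq0 : q != 0.
Proof.
by apply: contraNneq (qint_neq0 0) => ->; rewrite /qint invr0 subrr invr0 mulr0.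
Qed.
Let q_neq0 := q_neq0_of_qint_neq0.

Lemma qintD (a b : int) :
  qint q (a + b) = q ^ b * qint q a + q ^ (- a) * qint q b.
Proof. by rewrite /qint opprD !expfzDr //; ring. Qed.

Lemma qfactS n : qfact q n.+1 = qfact q n * qint q n.+1%:Z.
Proof. by rewrite /qfact big_nat_recr. Qed.

Lemma qfact0 : qfact q 0 = 1.
Proof. by rewrite /qfact big_geq. Qed.

Lemma qfact_neq0 n : qfact q n != 0.
Proof.
elim: n => [|n IHn]; first by rewrite qfact0 oner_neq0.
by rewrite qfactS mulf_neq0.
Qed.

(** The Gauss binomial at [q ^+ 2] is [q ^+ (l * m)] times the symmetric
    quantum binomial; the product form avoids division.  Pascal's rule becomes
    [qintD]. *)
Lemma gauss_binom_qfact l m :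
  gauss_binom (q ^+ 2) (l + m) l * (qfact q l * qfact q m)
  = q ^+ (l * m) * qfact q (l + m).
Proof.
elim: l m => [|l IHl] m.
  by rewrite gauss_binom0 qfact0 !mul1r.
elim: m => [|m IHm].
  rewrite addn0 muln0 qfact0 mulr1; congr (_ * _).
  elim: {IHl} l.+1 => // j IHj.
  by rewrite gauss_binomS subnn IHj gauss_binom_small // mul1r addr0.
rewrite addSn gauss_binomS addKn addnS -addSn.
have := IHl m.+1; rewrite addnS -addSn => IHl1.
rewrite mulrDl [qfact q (l.+1 + m).+1]qfactS -addnS PoszD qintD.
transitivity ((q ^+ 2) ^+ m.+1 * qint q l.+1%:Z
    * (q ^+ (l * m.+1) * qfact q (l.+1 + m))
  + qint q m.+1%:Z * (q ^+ (l.+1 * m) * qfact q (l.+1 + m))).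
  by rewrite -IHl1 -IHm !qfactS; ring.
have -> : q ^+ (l.+1 * m) = q ^+ (l.+1 * m.+1) * q ^ (- l.+1%:Z).
  by rewrite mulnS exprD -exprnN; field; rewrite expf_neq0.
have -> : q ^ m.+1%:Z = q ^+ m.+1 by [].
rewrite -exprM mul2n -addnn [(l.+1 * _)%N]mulSn !(exprD _ m.+1).
ring.
Qed.

End QuantumIntegers.

(** * The multiplicities and the exponent of q after a shift *)
Section Exponents.

Lemma bin2D a b : 'C(a + b, 2) = ('C(a, 2) + 'C(b, 2) + a * b)%N.
Proof.
by elim: a => [|a IHa]; rewrite ?bin0n ?addn0 // addSn !binS !bin1 IHa; lia.
Qed.

Lemma muln_pred_bin2 n : (n * (n - 1))%N = 'C(n, 2).*2.
Proof. by elim: n => // n IHn; rewrite binS bin1; nia. Qed.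

(** Needed with [sum_mults] to see that the truncated subtraction in [qexp]
    never truncates. *)
Lemma sum_bin2_leq (r : seq nat) :
  (\sum_(i <- r) 'C(i, 2) <= 'C(\sum_(i <- r) i, 2))%N.
Proof.
elim: r => [|i r IHr]; first by rewrite !big_nil.
by rewrite !big_cons bin2D -addnA leq_add2l (leq_trans IHr) ?leq_addr.
Qed.

Lemma sum_mults s : \sum_(l <- mults s) l = size s :> nat.
Proof.
rewrite -(perm_size (perm_count_undup s)) size_flatten sumnE /shape.
by rewrite !big_map; apply: eq_bigr => m _; rewrite size_nseq.
Qed.

Lemma mults_zeros_cons l t :
  mults (zeros_cons l t) = if l == 0%N then mults t else l :: mults t.
Proof.
have multsS u l' : [seq count_mem m (zeros_cons l' t) | m <- map S u]
    = [seq count_mem m t | m <- u].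
  rewrite -map_comp; apply: eq_map => m /=.
  rewrite count_cat count_nseq mul0n add0n count_map.
  by apply: eq_count => i /=.
case: l => [|l]; rewrite /mults.
  by rewrite -(multsS _ 0%N) -(undup_map_inj succn_inj).
have -> : undup (zeros_cons l.+1 t) = 0%N :: map S (undup t).
  elim: l => [|l IHl]; last exact: IHl.
  rewrite /= ifF; last by apply/mapP => -[].
  by rewrite (undup_map_inj succn_inj).
by rewrite map_cons multsS count0_zeros_cons.
Qed.

(** The value of [f] at [0] is the neutral element so that [l = 0], when [0]
    does not occur and contributes no multiplicity, needs no separate case. *)
Lemma big_mults_zeros_cons (V : Type) (idx : V) (op : Monoid.law idx) f l t :
  f 0%N = idx ->
  \big[op/idx]_(c <- mults (zeros_cons l t)) f c
  = op (f l) (\big[op/idx]_(c <- mults t) f c).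
Proof.
move=> f0; rewrite mults_zeros_cons; case: eqP => [->|_].
  by rewrite f0 Monoid.mul1m.
by rewrite big_cons.
Qed.

Definition qexp_weight (s : seq nat) : nat :=
  \sum_(1 <= i < (size s).+1) 2 * (i - 1) * nth 0 s (size s - i).

Lemma qexp_weight_cons a s :
  qexp_weight (a :: s) = (2 * size s * a + qexp_weight s)%N.
Proof.
rewrite /qexp_weight /= big_nat_recr //= subSS subn0 subnn addnC.
congr (_ + _)%N; apply: eq_big_nat => i /andP[_ lt_i].
by rewrite subSn.
Qed.

Lemma qexp_weight_zeros_cons l t :
  qexp_weight (zeros_cons l t) = (2 * 'C(size t, 2) + qexp_weight t)%N.
Proof.
rewrite /zeros_cons; elim: l => [|l IHl] /=; last first.
  by rewrite qexp_weight_cons muln0.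
elim: t => [|a t IHt] /=; first by rewrite /qexp_weight /= !big_geq.
by rewrite !qexp_weight_cons IHt size_map binS bin1; lia.
Qed.

Lemma qexpE s :
  qexp s = (qexp_weight s + ('C(size s, 2) - \sum_(l <- mults s) 'C(l, 2)))%N.
Proof.
congr (_ + _)%N; rewrite muln_pred_bin2 (eq_bigr (fun l => 2 * 'C(l, 2))%N).
  by rewrite -big_distrr /= mul2n -doubleB doubleK.
by move=> l _; rewrite muln_pred_bin2 mul2n.
Qed.

(** Raising the entries of [t] by one adds [2 (i - 1)] for each [i] up to
    [size t], and the [l] zeros add the cross term [l * size t] of
    ['C(l + size t, 2)]. *)
Lemma qexp_zeros_cons l t :
  qexp (zeros_cons l t) = (l * size t + 2 * 'C(size t, 2) + qexp t)%N.
Proof.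
rewrite !qexpE qexp_weight_zeros_cons size_zeros_cons bin2D.
rewrite big_mults_zeros_cons //=.
have := sum_bin2_leq (mults t); rewrite sum_mults.
lia.
Qed.

End Exponents.

(** * The powers of a current *)
Section CurrentPowers.
Variables (K : fieldType) (q : K).
Hypothesis qint_neq0 : forall n : nat, qint q n.+1%:Z != 0.

Lemma ccoef_nil : ccoef q [::] = 1.
Proof.
by rewrite /ccoef /mults /= big_nil qfact0 divr1 mul1r /qexp /mults /= !big_nil.
Qed.

(** The factor in front of [ccoef q t] is the coefficient of the term [l] in
    [qbinomial]; this is where the formula for the coefficients comes from. *)
Lemma ccoef_zeros_cons l t :
  ccoef q (zeros_cons l t)
  = gauss_binom (q ^+ 2) (l + size t) l * (q ^+ 2) ^+ 'C(size t, 2)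
    * ccoef q t.
Proof.
rewrite /ccoef size_zeros_cons qexp_zeros_cons.
rewrite (big_mults_zeros_cons _ _ _ (qfact0 q)) /= -exprM !exprD.
have e := gauss_binom_qfact qint_neq0 l (size t).
have {e} -> : gauss_binom (q ^+ 2) (l + size t) l
    = q ^+ (l * size t) * qfact q (l + size t) / (qfact q l * qfact q (size t)).
  by rewrite -e mulfK // mulf_neq0 ?qfact_neq0.
have prod_neq0 : \prod_(c <- mults t) qfact q c != 0.
  by rewrite prodf_seq_neq0; apply/allP => c _; apply: qfact_neq0.
by field; rewrite prod_neq0 !qfact_neq0.
Qed.

(** The induction on [n + k] is legitimate because the term of index [l]
    involves the exponent [n - l] and the degree [k - (n - l)], whose sum [k]
    is less than [n + k] for positive [n]. *)
Lemma coef_expr_sorted (A : algType K) (x : nat -> A) n k :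
  2%:R != 0 :> K -> quadratic_rel q x ->
  (Fps x ^+ n) k
  = \sum_(s <- sorted_seqs n k) ccoef q s *: \prod_(m <- s) x m.
Proof.
move=> nz2; have [N] := ubnP (n + k).
elim: N x n k => // N IHN x n k lt_N xP.
have [->|n_gt0] := posnP n.
  rewrite expr0 /sorted_seqs; case: k {lt_N} => [|k]; last by rewrite big_nil.
  by rewrite big_seq1 ccoef_nil big_nil scale1r.
rewrite (coef_expr_recursion n k nz2 xP) sum_sorted_seqs.
apply: eq_bigr => l _; case: ifP => [le_k|_]; last by rewrite mulr0 scaler0.
rewrite IHN; [|lia|exact: quadratic_relS].
rewrite mulr_sumr scaler_sumr big_seq [RHS]big_seq; apply: eq_bigr => t.
rewrite mem_sorted_seqs => /and3P[_ /eqP sz_t _].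
rewrite ccoef_zeros_cons sz_t subnKC -1?ltnS // -scalerAr scalerA.
congr (_ *: _).
by rewrite big_cat big_nseq -Monoid.iteropE big_map.
Qed.

Lemma is_int_laurentM a b :
  is_int_laurent q a -> is_int_laurent q b -> is_int_laurent q (a * b).
Proof.
move=> [f [i ->]] [g [j ->]]; exists (f * g), (i + j)%N.
by rewrite rmorphM hornerM exprD invfM mulrACA.
Qed.

Lemma is_int_laurentD a b :
  is_int_laurent q a -> is_int_laurent q b -> is_int_laurent q (a + b).
Proof.
move=> [f [i ->]] [g [j ->]]; exists (f * 'X^j + g * 'X^i), (i + j)%N.
rewrite rmorphD !rmorphM /= !map_polyXn !hornerE exprD.
by field; rewrite !expf_neq0 ?(q_neq0_of_qint_neq0 qint_neq0).
Qed.

Lemma is_int_laurentX n : is_int_laurent q (q ^+ n).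
Proof. by exists 'X^n, 0%N; rewrite map_polyXn hornerXn expr0 divr1. Qed.

Lemma is_int_laurent_gauss_binom n l :
  is_int_laurent q (gauss_binom (q ^+ 2) n l).
Proof.
have int1 : is_int_laurent q 1 by rewrite -(expr0 q); apply: is_int_laurentX.
have int0 : is_int_laurent q 0.
  by exists 0, 0%N; rewrite rmorph0 horner0 mul0r.
elim: n l => [|n IHn] [|l] //=.
apply: is_int_laurentD => //; apply: is_int_laurentM => //.
by rewrite -exprM; apply: is_int_laurentX.
Qed.

(** The defining quotient of factorials hides integrality; the recursion shows
    it, since Gauss binomials are built by Pascal's rule without division. *)
Lemma is_int_laurent_ccoef s : sorted leq s -> is_int_laurent q (ccoef q s).
Proof.
move: s; apply: sorted_zeros_ind => [|l t _ int_t].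
  by rewrite ccoef_nil -(expr0 q); apply: is_int_laurentX.
rewrite ccoef_zeros_cons -exprM; apply: is_int_laurentM => //.
apply: is_int_laurentM (is_int_laurentX _).
exact: is_int_laurent_gauss_binom.
Qed.

End CurrentPowers.

(** In a fixed degree only the finitely many sequences with that sum
    contribute, so the formal sum is checked one degree at a time. *)
Lemma is_fps_sum_sorted (A : pzRingType) (n : nat) (G : seq nat -> A)
    (f : fps A) :
  (forall k, f k = \sum_(s <- sorted_seqs n k) G s) ->
  is_fps_sum [set s : n.-tuple nat | sorted leq s]%classic
    (fun s => fps_monom (G s) (sumn s)) f.
Proof.
move=> coef_f k; pose r : seq (n.-tuple nat) := pmap insub (sorted_seqs n k).
have mem_r (s : n.-tuple nat) : (s \in r) = sorted leq s && (sumn s == k).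
  by rewrite mem_pmap_sub mem_sorted_seqs size_tuple eqxx.
split.
  apply: (sub_finite_set _ (finite_seq r)) => s [/= ss].
  by rewrite /= mem_r ss eq_sym; case: (sumn s == k).
rewrite (fsbigE r); last first.
- by move=> s /= ss; rewrite mem_r ss eq_sym /= => /negPf ->.
- by move=> s /=; rewrite mem_r => /andP[].
- exact/pmap_sub_uniq/sorted_seqs_uniq.
rewrite coef_f; have <- : map val r = sorted_seqs n k.
  rewrite /r (pmap_filter (@insubK _ _ _)); apply/all_filterP/allP => s.
  by rewrite mem_sorted_seqs isSome_insub => /and3P[].
rewrite big_map big_seq [RHS]big_seq_cond.
apply: eq_big => s; rewrite mem_r.
  by case: (boolP (sorted leq s)) => //= ss; rewrite mem_set ?andbT.
by case/andP=> _; rewrite /= eq_sym => ->.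
Qed.

(** A power of a single series is the same whether products of coefficients
    are read from the left or from the right. *)
Lemma coef_expr_converse (A : nzRingType) (x : nat -> A) n k :
  ((Fps x : fps A^c) ^+ n) k = (Fps x ^+ n) k.
Proof.
elim: n k => [|n IHn] k; first by rewrite !expr0.
rewrite exprS exprSr -[RHS]/(fps_mul (Fps x ^+ n) (Fps x) k) fps_mul_rev /=.
by apply: eq_bigr => i _; rewrite IHn.
Qed.


(** * The scalars and the currents of the quantum algebra *)
Lemma qint_neq0_not_unity (K : fieldType) (q : K) : q != 0 ->
  (forall k, (0 < k)%N -> q ^+ k != 1) ->
  forall n : nat, qint q n.+1%:Z != 0.
Proof.
move=> q_neq0 q_not_unity n.
have diff_neq0 k : (0 < k)%N -> q ^+ k - (q ^+ k)^-1 != 0.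
  move=> k_gt0; rewrite subr_eq0; apply: contra (q_not_unity (k + k)%N _).
    by rewrite exprD => /eqP e; rewrite {2}e divff // expf_neq0.
  by rewrite addn_gt0 k_gt0.
by rewrite mulf_neq0 ?invr_eq0 // ?(diff_neq0 1%N) // -exprnN diff_neq0.
Qed.

Section GenericScalars.
Variable R : realType.

Lemma qvar_neq0 : qvar R != 0.
Proof. by rewrite tofrac_eq0 polyX_eq0. Qed.

Lemma qvar_not_unity k : (0 < k)%N -> qvar R ^+ k != 1.
Proof.
move=> k_gt0; rewrite -tofracXn -tofrac1 tofrac_eq.
apply/eqP => /(congr1 (fun p : {poly R[i]} => size p)).
by rewrite size_polyXn size_poly1 => -[k0]; rewrite k0 in k_gt0.
Qed.

Lemma Cq_two_neq0 : 2%:R != 0 :> Cq R.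
Proof.
rewrite -(rmorph_nat (@tofrac {poly R[i]})) tofrac_eq0.
by rewrite -polyC_natr polyC_eq0 Num.Theory.pnatr_eq0.
Qed.

End GenericScalars.

Lemma posz_succ (m : nat) : (m%:Z + 1)%R = m.+1%:Z.
Proof. by rewrite -PoszD addn1. Qed.

Section Currents.
Variables (K : fieldType) (q : K).

Lemma to_quotB a b :
  to_quot _ (a - b) = to_quot _ a - to_quot _ b :> Uhat q.
Proof. by rewrite -[RHS]/(quot_add _ (quot_opp _)) quot_oppE quot_addE. Qed.

Lemma to_quotM a b :
  to_quot _ (a * b) = to_quot _ a * to_quot _ b :> Uhat q.
Proof. by rewrite -[RHS]/(quot_mul _ _) quot_mulE. Qed.

Lemma to_quotZ c a :
  to_quot _ (c *: a) = c *: to_quot _ a :> Uhat q.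
Proof. by rewrite -[RHS]/(quot_scale _ _) quot_scaleE. Qed.

Lemma Uhat_quadratic_rel (c : K) (a1 a2 a3 a4 : free_alg K Ugen) :
  Urel q (@free_gen K Ugen)
    (a1 * a2 - c *: (a2 * a1)) (c *: (a3 * a4) - a4 * a3) ->
  (to_quot _ a1 : Uhat q) * to_quot _ a2 - c *: (to_quot _ a2 * to_quot _ a1)
  = c *: (to_quot _ a3 * to_quot _ a4) - to_quot _ a4 * to_quot _ a3.
Proof.
move=> /rel_ideal_gen/to_quotP rel_a.
by rewrite -4!to_quotM -2!to_quotZ -2!to_quotB.
Qed.

Lemma Ux_quadratic_rel : quadratic_rel q (fun m : nat => Ux q m%:Z).
Proof.
move=> m n; apply: Uhat_quadratic_rel.
by rewrite -!posz_succ; apply: rel_xx.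
Qed.

(** The relation of the [y_m] multiplied by [- q ^+ 2] is the relation of the
    [x_m] with all products reversed. *)
Lemma Uy_quadratic_rel : q != 0 ->
  quadratic_rel q (fun m : nat => Uy q m%:Z : (Uhat q)^c).
Proof.
move=> q_neq0 m n.
have opp_scale (V : lmodType K) (c : K) (u1 u2 u3 u4 : V) : c != 0 ->
    u1 - c^-1 *: u2 = c^-1 *: u3 - u4 -> u2 - c *: u1 = c *: u4 - u3.
  move=> c_neq0 /(congr1 (fun u => - (c *: u))).
  by rewrite !scalerBr !scalerA divff // !scale1r !opprB.
apply: (opp_scale (Uhat q)); first exact: expf_neq0.
apply: Uhat_quadratic_rel.
by rewrite -!posz_succ; apply: rel_yy.
Qed.

End Currents.

Theorem theorem3p2 (R : realType) (n : nat) (hn : (1 <= n)%N) :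
  [/\ is_fps_sum [set s : n.-tuple nat | sorted leq s]%classic
        (fun s => fps_monom (ccoef (qvar R) s *: \prod_(m <- s) Ux (qvar R) m%:Z) (sumn s))
        (Xplus (qvar R) ^+ n),
      is_fps_sum [set s : n.-tuple nat | sorted leq s]%classic
        (fun s => fps_monom (ccoef (qvar R) s *: \prod_(m <- rev s) Uy (qvar R) m%:Z) (sumn s))
        (Yplus (qvar R) ^+ n)
    & forall s : n.-tuple nat, sorted leq s -> is_int_laurent (qvar R) (ccoef (qvar R) s)].
Proof.
have q_neq0 := qvar_neq0 R; have two_neq0 := Cq_two_neq0 R.
have qint_neq0 := qint_neq0_not_unity q_neq0 (@qvar_not_unity R).
split=> [||s]; last exact: is_int_laurent_ccoef.
- apply: (is_fps_sum_sorted (G := fun s =>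
    ccoef (qvar R) s *: \prod_(m <- s) Ux (qvar R) m%:Z)) => k.
  exact: (coef_expr_sorted qint_neq0 _ _ two_neq0 (Ux_quadratic_rel _)).
- apply: (is_fps_sum_sorted (G := fun s =>
    ccoef (qvar R) s *: \prod_(m <- rev s) Uy (qvar R) m%:Z)) => k.
  rewrite -coef_expr_converse.
  rewrite (coef_expr_sorted qint_neq0 _ _ two_neq0 (Uy_quadratic_rel q_neq0)).
  by apply: eq_bigr => s _; rewrite rev_prodr.
Qed.
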